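(* There is a sequence $(T_n)_{n\ge 1}$ of finite posets of width $2$ such that $$\lim_{n\to\infty}\delta(T_n)=\beta=\frac{5864893+27\sqrt{57}}{16812976}.$$
   Context: The width of a finite poset is the maximum size of an antichain. A linear extension of a finite poset $(P,\le)$ is a total order on $P$ extending $\le$. For $x,y\in P$, $\mathbb{P}(x\prec y)$ denotes the probability that $x$ strictly precedes $y$ in a uniformly random linear extension of $P$, with the convention $\mathbb{P}(x\prec x)=0$. The balance constant of $P$ is $$\delta(P)=\max_{(x,y)\in P^2}\min\{\mathbb{P}(x\prec y),\mathbb{P}(y\prec x)\}.$$ *)

(* Defs.v *)
From HB Require Import structures.
From mathcomp Require Import all_boot all_order all_algebra.

Set Implicit Arguments.
Unset Strict Implicit.
Unset Printing Implicit Defensive.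

Import Order.TTheory GRing.Theory Num.Theory.

Section FinPoset.
Variables (d : Order.disp_t) (P : finPOrderType d).

Definition antichain (A : {set P}) : bool :=
  [forall x in A, forall y in A, (x != y) ==> (x >< y)%O].

Definition width : nat := \max_(A : {set P} | antichain A) #|A|.

(* A binary relation on P is represented by its graph L, so that relations
   form a finType: (x, y) \in L reads "x is below or equal to y in L". *)
Definition linear_extension (L : {set P * P}) : bool :=
  [&& [forall x, (x, x) \in L],
      [forall x, forall y, ((x, y) \in L) && ((y, x) \in L) ==> (x == y)],
      [forall x, forall y, forall z,
         ((x, y) \in L) && ((y, z) \in L) ==> ((x, z) \in L)],
      [forall x, forall y, ((x, y) \in L) || ((y, x) \in L)]
    & [forall x, forall y, (x <= y)%O ==> ((x, y) \in L)]].

Lemma linear_extensionP (L : {set P * P}) (r := fun x y => (x, y) \in L) :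
  reflect [/\ reflexive r, antisymmetric r, transitive r, total r
            & forall x y, (x <= y)%O -> r x y]
          (linear_extension L).
Proof.
apply: (iffP and5P) => [] [rfl asym trs tot ext]; split.
- by move=> x; exact: (forallP rfl x).
- move=> x y rxy; apply/eqP.
  by move/forallP/(_ x)/forallP/(_ y)/implyP: asym; apply.
- move=> y x z rxy ryz.
  move/forallP/(_ x)/forallP/(_ y)/forallP/(_ z)/implyP: trs; apply.
  exact/andP.
- by move=> x y; exact: (forallP (forallP tot x) y).
- by move=> x y; move/forallP/(_ x)/forallP/(_ y)/implyP: ext.
- exact/forallP.
- by apply/forallP=> x; apply/forallP=> y; apply/implyP=> /asym ->.
- apply/forallP=> x; apply/forallP=> y; apply/forallP=> z.
  by apply/implyP=> /andP[rxy ryz]; exact: trs rxy ryz.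
- by apply/forallP=> x; apply/forallP=> y; exact: tot.
- by apply/forallP=> x; apply/forallP=> y; apply/implyP; exact: ext.
Qed.

Definition linear_extensions : {set {set P * P}} :=
  [set L | linear_extension L].

Local Open Scope ring_scope.
Variable R : realFieldType.

Definition proba_prec (x y : P) : R :=
  #|[set L in linear_extensions | (x != y) && ((x, y) \in L)]|%:R
    / #|linear_extensions|%:R.

(* The default value 0 of the iterated maximum is harmless: every term is
   nonnegative, and the diagonal terms (x, x) are equal to 0. *)
Definition balance_constant : R :=
  \big[Num.max/0]_(p : P * P)
    Num.min (proba_prec p.1 p.2) (proba_prec p.2 p.1).

End FinPoset.

Arguments width {d} P.
Arguments linear_extensions {d} P.
Arguments proba_prec {d P} R x y.
Arguments balance_constant {d} P R.

(* Main.v *)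
Require Import Defs.
From HB Require Import structures.
From mathcomp Require Import all_boot all_order all_algebra.
From mathcomp Require Import zify ring lra.
From mathcomp Require Import all_classical all_reals all_analysis.

(* A width-two poset made of chains a_0 < a_1 < ... and b_0 < b_1 < ... is
   given by the interval in which h_i, the number of b's below a_i, may vary in
   a linear extension; linear extensions are then the nondecreasing sequences h
   with each h_i in its interval.  The posets used here are ladders made of
   blocks: block k constrains both h_(2k) and h_(2k+1) to [2k, 2k+3], and a
   broken rung shrinks one of these two intervals by one.  From the left the
   pattern is broken, broken, full, full, broken, then K full blocks, and the
   pattern is repeated upside down on the right.

   Counting is a transfer of pairs (A, B) across the blocks, a full block acting
   as (A, B) |-> (3A + 3B, 4A + 6B), whose slope B / A has the attracting fixed
   point (3 + sqrt 57) / 6.  Every event h_i <= j has a probability that is a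
   bilinear expression in the pairs coming from both ends.  Bounding the slopes
   in fixed intervals shows that every pair of elements other than the first
   one, (a_0, b_0), and its mirror image, has balance at most 15/43, whereas
   the pair (a_0, b_0) has balance at least 15/43, hence realizes the balance
   constant.  Its balance is a homography in the slope after K full blocks and
   tends to the announced constant. *)

Set Implicit Arguments.
Unset Strict Implicit.
Unset Printing Implicit Defensive.

Import Order.TTheory GRing.Theory Num.Theory.
Import numFieldNormedType.Exports.

(** * Linear extensions as staircases *)

Definition in_wall (h : nat) (J : nat * nat) := J.1 <= h <= J.2.

(** The argument [p] is the height already reached, so that the enumeration can resume after any
    prefix. *)
Fixpoint stairs (s : seq (nat * nat)) (p : nat) : seq (seq nat) :=
  if s is J :: s' then
    [seq h :: t | h <- iota (maxn J.1 p) (J.2.+1 - maxn J.1 p),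
                  t <- stairs s' h]
  else [:: [::]].

Lemma mem_stairs s p t :
  (t \in stairs s p) = path leq p t && all2 in_wall t s.
Proof.
elim: s p t => [|J s IHs] p [|h t] //=; first by rewrite andbF.
  by apply/negP => /allpairsPdep[x [y []]].
rewrite /in_wall.
apply/allpairsPdep/idP => [[h' [t' []]]|].
  rewrite mem_iota => hh' t't [-> ->]; move: t't; rewrite IHs => /andP[-> ->].
  by rewrite !andbT; lia.
move=> /andP[/andP[ph pt] /andP[hI tI]]; exists h, t; split=> //.
  by rewrite mem_iota; lia.
by rewrite IHs pt tI.
Qed.

Lemma stairs_uniq s p : uniq (stairs s p).
Proof.
elim: s p => [|J s IHs] p //=.
apply: allpairs_uniq_dep => //; first exact: iota_uniq.
by move=> [x1 x2] [y1 y2] _ _ /= [-> ->].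
Qed.

Lemma size_in_stairs s p t : t \in stairs s p -> size t = size s.
Proof. by rewrite mem_stairs all2E => /andP[_ /andP[/eqP]]. Qed.

Definition wall_le (I J : nat * nat) := (I.1 <= J.1) && (I.2 <= J.2).

Lemma wall_le_trans : transitive wall_le.
Proof. by move=> J I K; rewrite /wall_le => /andP[? ?] /andP[? ?]; lia. Qed.

Lemma wall_le_refl : reflexive wall_le.
Proof. by move=> J; rewrite /wall_le !leqnn. Qed.

Record strip := Strip {
  walls : seq (nat * nat);
  height : nat;
  walls_sorted : sorted wall_le walls;
  walls_bounded : all (fun J => J.1 <= J.2 <= height) walls
}.

(* The chain ['I_(size walls)] is [a_0 < a_1 < ...], the chain ['I_height] is
   [b_0 < b_1 < ...]; wall [(l, u)] of [a_i] means that exactly [b_j], [j < l],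
   lie below [a_i] and exactly [b_j], [u <= j], lie above it. *)
Definition strip_carrier (S : strip) := ('I_(size (walls S)) + 'I_(height S))%type.

(** The bounds [f] and [g] are separate so that one relation gives both the partial order of a strip
    ([lo] and [hi]) and, when they coincide, the linear order of a staircase. *)
Definition sheet m n (f g : nat -> nat) : rel ('I_m + 'I_n) := fun x y =>
  match x, y with
  | inl i, inl i' => i <= i'
  | inr j, inr j' => j <= j'
  | inr j, inl i => j < f i
  | inl i, inr j => g i <= j
  end.

Section Sheet.
Variables (m n : nat) (f g : nat -> nat).
Hypothesis f_homo : forall i j, i <= j < m -> f i <= f j.
Hypothesis g_homo : forall i j, i <= j < m -> g i <= g j.
Hypothesis fg : forall i, i < m -> f i <= g i.

Lemma sheet_refl : reflexive (@sheet m n f g).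
Proof. by case=> i /=. Qed.

Lemma sheet_anti : antisymmetric (@sheet m n f g).
Proof.
have H (i : 'I_m) (j : 'I_n) : ~ ((g i <= j) && (j < f i)).
  by have := fg (ltn_ord i); lia.
case=> i [] j //=.
- by move=> ?; congr inl; apply/val_inj => /=; lia.
- by move/H.
- by rewrite andbC => /H.
- by move=> ?; congr inr; apply/val_inj => /=; lia.
Qed.

Lemma sheet_trans : transitive (@sheet m n f g).
Proof.
case=> i [] j [] k //=.
- by move=> *; lia.
- by have := @g_homo j i; have := ltn_ord i; lia.
- by have := @f_homo i k; have := ltn_ord k; lia.
- by have := fg (ltn_ord i); lia.
- have := @f_homo k j; have := fg (ltn_ord j); have := ltn_ord j.
  by case: (leqP k j); lia.
- by move=> *; lia.
- by move=> *; lia.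
- by move=> *; lia.
Qed.

End Sheet.

Lemma sheet_total m n f : total (@sheet m n f f).
Proof. by case=> i [] j /=; lia. Qed.

Section StripTheory.
Variable S : strip.
Local Notation m := (size (walls S)).
Local Notation n := (height S).

Definition lo i := (nth (0, 0) (walls S) i).1.
Definition hi i := (nth (0, 0) (walls S) i).2.

Lemma wall_homo i j : i <= j < m -> (lo i <= lo j) && (hi i <= hi j).
Proof.
move=> ij.
apply: (sorted_leq_nth wall_le_trans wall_le_refl (0, 0) (walls_sorted S)).
- by rewrite inE; lia.
- by rewrite inE; lia.
- by lia.
Qed.

Lemma lo_homo i j : i <= j < m -> lo i <= lo j.
Proof. by move/wall_homo/andP => []. Qed.

Lemma hi_homo i j : i <= j < m -> hi i <= hi j.
Proof. by move/wall_homo/andP => []. Qed.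

Lemma wall_bounds i : i < m -> lo i <= hi i <= n.
Proof. by move=> im; exact: (all_nthP (0, 0) (walls_bounded S)). Qed.

Lemma lo_hi i : i < m -> lo i <= hi i.
Proof. by move/wall_bounds/andP => []. Qed.

HB.instance Definition _ := Finite.on (strip_carrier S).
HB.instance Definition _ :=
  Order.Le_isPOrder.Build (Order.Disp tt tt) (strip_carrier S)
    (@sheet_refl m n lo hi) (@sheet_anti m n _ _ lo_hi)
    (@sheet_trans m n _ _ lo_homo hi_homo lo_hi).

Local Notation P := (strip_carrier S).

Lemma strip_leE (x y : P) : (x <= y)%O = sheet lo hi x y.
Proof. by []. Qed.

Definition stair_graph (t : seq nat) : {set P * P} :=
  [set p | sheet (nth 0 t) (nth 0 t) p.1 p.2].

Lemma stair_nth t : t \in stairs (walls S) 0 ->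
  [/\ size t = m, forall i j, i <= j < m -> nth 0 t i <= nth 0 t j
    & forall i, i < m -> lo i <= nth 0 t i <= hi i].
Proof.
move=> tS; have sz := size_in_stairs tS; move: tS.
rewrite mem_stairs all2E sz eqxx /= => /andP[/path_sorted st /all_nthP al].
split=> // [i j ij|i im].
  by apply: (sorted_leq_nth leq_trans leqnn 0 st); rewrite ?inE ?sz; lia.
have := al (0, (0, 0)) i; rewrite size_zip sz minnn nth_zip // => /(_ im).
by rewrite /in_wall /=.
Qed.

Lemma stair_graph_ext t : t \in stairs (walls S) 0 ->
  stair_graph t \in linear_extensions P.
Proof.
move=> /stair_nth[sz hom bnd]; rewrite inE; apply/linear_extensionP; split.
- by move=> x; rewrite inE /=; exact: sheet_refl.
- by move=> x y; rewrite !inE /=; apply: sheet_anti.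
- by move=> y x z; rewrite !inE /=; apply: sheet_trans.
- by move=> x y; rewrite !inE /=; exact: sheet_total.
- move=> [] i [] j; rewrite inE strip_leE //=.
    by have := bnd i (ltn_ord i); lia.
  by have := bnd j (ltn_ord j); lia.
Qed.

Lemma stair_graph_inj : {in stairs (walls S) 0 &, injective stair_graph}.
Proof.
suff H t t' i : t \in stairs (walls S) 0 -> t' \in stairs (walls S) 0 ->
    i < m -> stair_graph t = stair_graph t' -> nth 0 t i <= nth 0 t' i.
  move=> t t' tS t'S eqg; have [[sz _ _] [sz' _ _]] := (stair_nth tS, stair_nth t'S).
  apply: (@eq_from_nth _ 0); first by rewrite sz sz'.
  by move=> i; rewrite sz => im; apply/eqP; rewrite eqn_leq !H.
move=> /stair_nth[sz _ bnd] /stair_nth[sz' _ bnd'] im /setP eqg.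
rewrite leqNgt; apply/negP => lt.
(* The [b] of index [nth 0 t' i] lies below [a_i] for [t] but not for [t']. *)
have jn : nth 0 t' i < n by have := bnd i im; have := wall_bounds im; lia.
have := eqg (inr (Ordinal jn), inl (Ordinal im)); rewrite !inE /= lt.
by rewrite ltnn.
Qed.

Lemma down_closed_threshold k (D : pred nat) :
  (forall j j', j <= j' < k -> D j' -> D j) ->
  exists2 h, h <= k & forall j, j < k -> D j = (j < h).
Proof.
elim: k => [|k IHk] dc; first by exists 0.
have [j j' jj'|h hk Dh] := IHk; first by apply: dc; lia.
have [Dk|nDk] := boolP (D k).
  exists k.+1 => // j jk; rewrite jk; apply: dc Dk; lia.
exists h; first lia.
move=> j; rewrite ltnS leq_eqVlt => /orP[/eqP->|/Dh //].
by rewrite (negbTE nDk); lia.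
Qed.

(** In a linear extension the [b]'s below [a_i] form an initial segment of their chain; its length
    is the height of the staircase at [i]. *)
Lemma ext_stair_graph L : L \in linear_extensions P ->
  exists2 t, t \in stairs (walls S) 0 & L = stair_graph t.
Proof.
rewrite inE => /linear_extensionP[rfl asy trs tot ext].
have /fin_all_exists[f fP] (i : 'I_m) : exists h, h <= n /\
    forall j : 'I_n, ((inr j, inl i) \in L) = (j < h).
  have [j j' jj'|h hn Dh] := @down_closed_threshold n
      (fun j => if insub j is Some o then (inr o, inl i) \in L else false).
    rewrite !insubT; try lia; move=> h1 h2 L1.
    apply: trs L1; apply: ext; rewrite strip_leE /=; lia.
  exists h; split=> // j; rewrite -Dh // insubT //= => ?.
  by congr ((inr _, _) \in L); exact: val_inj.
have fn i : f i <= n by case: (fP i).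
have fL i j : ((inr j, inl i) \in L) = (j < f i) by case: (fP i).
pose t := [seq f i | i <- enum 'I_m].
have sz : size t = m by rewrite size_map size_enum_ord.
have tE (i : 'I_m) : nth 0 t i = f i.
  by rewrite (nth_map i) ?size_enum_ord // nth_ord_enum.
exists t.
  rewrite mem_stairs all2E sz eqxx /=; apply/andP; split.
    have : sorted leq t.
      apply/(sortedP 0) => i; rewrite sz => im.
      have i'm : i < m by lia.
      rewrite (tE (Ordinal im)) (tE (Ordinal i'm)).
      set x := Ordinal i'm; set y := Ordinal im; rewrite leqNgt; apply/negP => lt.
      have jn : f y < n by apply: leq_trans lt _.
      (* The [b] of index [f y] would lie below [a_x], hence below [a_y], whereas only indices less
         than [f y] do. *)
      have := fL y (Ordinal jn); rewrite /= ltnn => /negP; apply.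
      apply: (trs (inl x)); first by rewrite fL.
      by apply: ext; rewrite strip_leE /=.
    by case: (t) => //= x u ->.
  apply/(all_nthP (0, (0, 0))) => i; rewrite size_zip sz minnn => im.
  rewrite nth_zip //= /in_wall -[_.1]/(lo i) -[_.2]/(hi i).
  rewrite (tE (Ordinal im)); set x := Ordinal im.
  have bnd := wall_bounds im.
  apply/andP; split; rewrite leqNgt; apply/negP => lt.
    have jn : f x < n by lia.
    have := fL x (Ordinal jn); rewrite /= ltnn => /negP; apply.
    by apply: ext; rewrite strip_leE /=.
  have jn : hi i < n by apply: leq_trans lt _.
  have := asy (inr (Ordinal jn)) (inl x); rewrite fL /= lt /=.
  by rewrite ext ?strip_leE //= => /(_ isT).
apply/setP => -[x y]; rewrite inE /=.
case: x y => i [] j /=.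
- case: (leqP i j) => ij; first exact: ext.
  apply/negP => /(conj (ext (inl j) (inl i) (ltnW ij))) /andP/asy[ji].
  by rewrite ji ltnn in ij.
- rewrite tE leqNgt -fL.
  apply/idP/idP => [Lij|/negbTE nL]; first apply/negP => Lji.
    by have := asy (inl i) (inr j); rewrite Lij Lji => /(_ isT).
  by have := tot (inl i) (inr j); rewrite nL orbF.
- by rewrite fL tE.
- case: (leqP i j) => ij; first exact: ext.
  apply/negP => /(conj (ext (inr j) (inr i) (ltnW ij))) /andP/asy[ji].
  by rewrite ji ltnn in ij.
Qed.

Lemma card_linear_extensions (Q : pred {set P * P}) :
  #|[set L in linear_extensions P | Q L]| =
  count (fun t => Q (stair_graph t)) (stairs (walls S) 0).
Proof.
rewrite -size_filter -(size_map stair_graph).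
have -> : [set L in linear_extensions P | Q L] =
    [set L in [seq stair_graph t | t <- stairs (walls S) 0 & Q (stair_graph t)]].
  apply/setP => L; rewrite !inE; apply/andP/mapP.
    move=> [LE QL].
    have /ext_stair_graph[t tS LE'] : L \in linear_extensions P by rewrite inE.
    by exists t => //; rewrite mem_filter tS -LE' QL.
  move=> [t]; rewrite mem_filter => /andP[Qt tS] ->; split=> //.
  by have := stair_graph_ext tS; rewrite inE.
rewrite cardsE; apply/card_uniqP; rewrite map_inj_in_uniq.
  exact/filter_uniq/stairs_uniq.
move=> t t'; rewrite !mem_filter => /andP[_ ?] /andP[_ ?].
exact: stair_graph_inj.
Qed.

End StripTheory.

(** * Width and balance constant of a strip *)

Section StripBalance.
Variable S : strip.
Local Notation m := (size (walls S)).
Local Notation n := (height S).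
Local Notation P := (strip_carrier S).

Lemma width_strip (i : 'I_m) (j : 'I_n) :
  lo S i <= j < hi S i -> width P = 2.
Proof.
move=> /andP[lij jhi]; apply/eqP; rewrite eqn_leq; apply/andP; split.
  apply/bigmax_leqP => A /forallP anti.
  (* An antichain meets each of the two chains at most once, so the side is injective on [A]. *)
  pose f (x : P) : bool := if x is inl _ then true else false.
  rewrite -(card_in_imset (f := f)); first by rewrite -card_bool max_card.
  move=> x y xA yA fxy; apply/eqP; apply: contraT => nxy.
  have := anti x; rewrite xA => /forallP/(_ y); rewrite yA nxy /=.
  rewrite /Order.comparable !strip_leE.
  by case: x y fxy {xA yA nxy} => k [] l //= _; lia.
have -> : 2 = #|[set (inl i : P); inr j]| by rewrite cards2.
apply: (@leq_bigmax_cond _ _ (fun A : {set P} => #|A|)).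
apply/forallP => x; apply/implyP => xA; apply/forallP => y; apply/implyP => yA.
apply/implyP; move: xA yA; rewrite !inE /Order.comparable !strip_leE.
by case/orP => /eqP-> /orP[] /eqP->; rewrite ?eqxx //=; lia.
Qed.

Local Open Scope ring_scope.
Variable R : realFieldType.
Local Notation paths := (stairs (walls S) 0).

Lemma proba_comparable (x y : P) : (x <= y)%O -> proba_prec R y x = 0.
Proof.
move=> xy; rewrite /proba_prec (_ : [set _ in _ | _] = finset.set0) ?cards0 ?mul0r //.
apply/setP => L; rewrite !inE; apply/negP => /and3P[].
move=> /linear_extensionP[_ asy _ _ ext] nyx Lyx.
by move: nyx; rewrite (asy y x) ?eqxx // Lyx ext.
Qed.

Lemma proba_inl_inr (i : 'I_m) (j : 'I_n) :
  proba_prec R (inl i : P) (inr j) =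
  (count (fun t => (nth 0 t i <= j)%N) paths)%:R / (size paths)%:R.
Proof.
have sz := card_linear_extensions (S := S) predT.
rewrite count_predT in sz; rewrite /proba_prec card_linear_extensions -sz.
congr (_%:R / _%:R).
  by apply: eq_count => t; rewrite inE.
by apply: eq_card => L; rewrite !inE andbT.
Qed.

Lemma proba_inr_inl (i : 'I_m) (j : 'I_n) :
  proba_prec R (inr j : P) (inl i) =
  (count (fun t => (j < nth 0 t i)%N) paths)%:R / (size paths)%:R.
Proof.
have sz := card_linear_extensions (S := S) predT.
rewrite count_predT in sz; rewrite /proba_prec card_linear_extensions -sz.
congr (_%:R / _%:R).
  by apply: eq_count => t; rewrite inE.
by apply: eq_card => L; rewrite !inE andbT.
Qed.

Definition cut_balance i j : R :=
  Num.min (count (fun t => (nth 0 t i <= j)%N) paths)%:R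
          (count (fun t => (j < nth 0 t i)%N) paths)%:R / (size paths)%:R.

Lemma cut_balance_proba (i : 'I_m) (j : 'I_n) :
  Num.min (proba_prec R (inl i : P) (inr j)) (proba_prec R (inr j : P) (inl i)) =
  cut_balance i j.
Proof. by rewrite proba_inl_inr proba_inr_inl /cut_balance minr_pMl // invr_ge0 ler0n. Qed.

(** Comparable pairs contribute 0, and [lo S i <= j < hi S i] says exactly that [a_i] and [b_j] are
    incomparable. *)
Lemma balance_constant_eq i0 j0 : (i0 < m)%N -> (j0 < n)%N ->
  (forall i j, (i < m)%N -> (lo S i <= j < hi S i)%N ->
     cut_balance i j <= cut_balance i0 j0) ->
  balance_constant P R = cut_balance i0 j0.
Proof.
move=> i0m j0n le_cut.
have c_ge0 i j : 0 <= cut_balance i j.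
  by rewrite divr_ge0 // ?ler0n // le_min !ler0n.
have proba_ge0 (x y : P) : 0 <= proba_prec R x y by rewrite divr_ge0 // ler0n.
have comp (x y : P) : (x >=< y)%O ->
    Num.min (proba_prec R x y) (proba_prec R y x) <= cut_balance i0 j0.
  case/orP=> /proba_comparable->; apply: le_trans (c_ge0 i0 j0).
    by rewrite ge_min lexx orbT.
  by rewrite ge_min lexx.
have cut (i : 'I_m) (j : 'I_n) :
    ~~ ((inl i : P) >=< inr j)%O -> cut_balance i j <= cut_balance i0 j0.
  rewrite /Order.comparable !strip_leE /= negb_or -!ltnNge => /andP[jhi lij].
  by apply: le_cut => //; rewrite -ltnS lij.
apply/eqP; rewrite eq_le; apply/andP; split.
  apply: bigmax_le => // -[x y] _ /=.
  have [/comp//|] := boolP (x >=< y)%O.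
  case: x y => i [] j nc.
  - by move: nc; rewrite /Order.comparable !strip_leE /= leq_total.
  - by rewrite cut_balance_proba; apply: cut.
  - by rewrite minC cut_balance_proba; apply: cut; rewrite comparable_sym.
  - by move: nc; rewrite /Order.comparable !strip_leE /= leq_total.
rewrite -(cut_balance_proba (Ordinal i0m) (Ordinal j0n)).
exact: (le_bigmax _ (fun p : P * P => Num.min (proba_prec R p.1 p.2) (proba_prec R p.2 p.1)) (inl _, inr _)).
Qed.

End StripBalance.

(** * Counting staircases block by block *)

Definition lift_wall k (J : nat * nat) := (k + J.1, k + J.2).

(** The truncation in [p - k] is harmless: lifted walls start at [k] or higher, so an entry height
    below [k] imposes nothing. *)
Lemma stairs_lift k s p :
  stairs (map (lift_wall k) s) p = map (map (addn k)) (stairs s (p - k)).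
Proof.
elim: s p => [|J s IHs] p //=.
rewrite map_flatten -!map_comp.
have -> : maxn (k + J.1) p = k + maxn J.1 (p - k) by lia.
rewrite (_ : (k + J.2).+1 - _ = J.2.+1 - maxn J.1 (p - k)); last by lia.
rewrite iotaDl -map_comp; congr flatten; apply: eq_map => h /=.
by rewrite IHs -!map_comp addKn; apply: eq_map => t.
Qed.

Lemma count_stairs_cat Q s1 s2 p :
  count Q (stairs (s1 ++ s2) p) =
  \sum_(t1 <- stairs s1 p) count (fun t => Q (t1 ++ t)) (stairs s2 (last p t1)).
Proof.
elim: s1 Q p => [|J s IHs] Q p /=; first by rewrite big_seq1.
rewrite count_flatten sumnE !big_map big_allpairs_dep /=.
by apply: eq_bigr => h _; rewrite count_map IHs.
Qed.

(* A block is described relatively to its own base 2k.  [NoLeft] lacks the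
   staircases entering at height 0 in both columns, [NoRight] those reaching
   height 3 in both columns. *)
Inductive block := Full | NoLeft | NoRight.

Definition block_walls c :=
  match c with
  | Full => [:: (0, 3); (0, 3)]
  | NoLeft => [:: (0, 3); (1, 3)]
  | NoRight => [:: (0, 2); (0, 3)]
  end.

Fixpoint ladder_walls (bs : seq block) : seq (nat * nat) :=
  if bs is c :: bs' then block_walls c ++ map (lift_wall 2) (ladder_walls bs')
  else [::].

Lemma size_ladder_walls bs : size (ladder_walls bs) = (size bs).*2.
Proof. by elim: bs => [|[] bs IHbs] //=; rewrite size_map IHbs. Qed.

Lemma ladder_walls_sorted bs : sorted wall_le (ladder_walls bs).
Proof.
(* Lifting by 2 turns this lower bound into [(2, 4)], which dominates every wall of a block. *)
have low bs' : all (wall_le (0, 2)) (ladder_walls bs').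
  elim: bs' => [|c bs' IHbs] //=; rewrite all_cat all_map.
  apply/andP; split; first by case: c.
  apply: sub_all IHbs => J; rewrite /wall_le /=; lia.
elim: bs => [|c bs IHbs] //=.
have srt : sorted wall_le (map (lift_wall 2) (ladder_walls bs)).
  rewrite sorted_map; apply: sub_sorted IHbs => I J.
  by rewrite /wall_le /=; lia.
have pth J : wall_le J (2, 4) ->
    path wall_le J (map (lift_wall 2) (ladder_walls bs)).
  move=> J24; rewrite path_sortedE ?srt ?andbT; last exact: wall_le_trans.
  rewrite all_map; apply: sub_all (low bs) => I /=.
  by move: J24; rewrite /wall_le /=; lia.
by case: c => /=; rewrite pth.
Qed.

(** The last block has base [2 (size bs - 1)] and reaches 3 above it. *)
Lemma ladder_walls_bounded bs :
  all (fun J => J.1 <= J.2 <= (size bs).*2.+1) (ladder_walls bs).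
Proof.
elim: bs => [|c bs IHbs] //=; rewrite all_cat all_map; apply/andP; split.
  by case: c => /=; lia.
apply: sub_all IHbs => J /=; lia.
Qed.

Definition ladder bs : strip :=
  Strip (ladder_walls_sorted bs) (ladder_walls_bounded bs).

Lemma nth_ladder_walls bs k e : k < size bs -> e < 2 ->
  nth (0, 0) (ladder_walls bs) (k.*2 + e) =
  lift_wall k.*2 (nth (0, 0) (block_walls (nth Full bs k)) e).
Proof.
elim: bs k => [|c bs IHbs] // [|k] /= kb e2.
  by rewrite add0n; case: c; move: e2; case: (e) => [|[|]].
have sz2 : size (block_walls c) = 2 by case: c.
rewrite nth_cat sz2 ltnNge (_ : 2 <= _) /=; last by lia.
rewrite (_ : _ - 2 = k.*2 + e); last by lia.
have lt : k.*2 + e < size (ladder_walls bs) by rewrite size_ladder_walls; lia.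
by rewrite (nth_map (0, 0)) // IHbs //; congr pair => /=; lia.
Qed.

(* The truncated subtractions are harmless: both heights of block [k] are at
   least [2k]. *)
Definition local_event (q : rel nat) k (t : seq nat) :=
  q (nth 0 t k.*2 - k.*2) (nth 0 t k.*2.+1 - k.*2).

Lemma nth_map_addn k t i : nth 0 (map (addn k) t) i - k = nth 0 t i.
Proof.
have [it|ti] := ltnP i (size t); first by rewrite (nth_map 0) // addKn.
by rewrite !nth_default ?size_map.
Qed.

Lemma count_ladder_cons q k c bs p :
  count (local_event q k.+1) (stairs (ladder_walls (c :: bs)) p) =
  \sum_(t1 <- stairs (block_walls c) p)
     count (local_event q k) (stairs (ladder_walls bs) (last p t1 - 2)).
Proof.
rewrite count_stairs_cat; apply: eq_big_seq => t1 /size_in_stairs t1c.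
rewrite stairs_lift count_map; apply: eq_count => t /=.
have sz2 : size t1 = 2 by rewrite t1c; case: c {t1c}.
rewrite /local_event !nth_cat sz2 !doubleS /= !subSS !subn0.
have sub2 x : x - k.*2.+2 = x - 2 - k.*2 by lia.
by rewrite !sub2 !nth_map_addn.
Qed.

Lemma count_ladder_head q c bs p :
  count (local_event q 0) (stairs (ladder_walls (c :: bs)) p) =
  \sum_(t1 <- stairs (block_walls c) p)
     q (nth 0 t1 0) (nth 0 t1 1) *
     size (stairs (ladder_walls bs) (last p t1 - 2)).
Proof.
rewrite count_stairs_cat; apply: eq_big_seq => t1 /size_in_stairs t1c.
have sz2 : size t1 = 2 by rewrite t1c; case: c {t1c}.
rewrite stairs_lift count_map -(size_map (map (addn 2))) size_map.
under eq_count => t do rewrite /= /local_event !nth_cat sz2 /= !subn0.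
by case: q; rewrite ?mul1n ?mul0n ?count_predT ?count_pred0.
Qed.

(** * Transfer of weights across blocks *)

Section Weights.
Local Open Scope ring_scope.
Variable R : realFieldType.
Implicit Types (v w : R * R).

(** Half-turn of a block: the columns are swapped and a relative height [h] becomes [3 - h]. *)
Definition mirror c :=
  match c with Full => Full | NoLeft => NoRight | NoRight => NoLeft end.

(* In a pair [(A, B)] describing the blocks on the left of a given block, [B]
   counts the staircases through them that can be continued at relative height
   at least 1, that is all of them, and [A] those that can be continued at
   relative height 0.  Pairs for the blocks on the right are the same thing
   upside down. *)
Definition step c v : R * R :=
  match c with
  | Full => (3%:R * v.1 + 3%:R * v.2, 4%:R * v.1 + 6%:R * v.2)
  | NoLeft => (2%:R * v.1 + 3%:R * v.2, 3%:R * v.1 + 6%:R * v.2)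
  | NoRight => (3%:R * v.1 + 3%:R * v.2, 4%:R * v.1 + 5%:R * v.2)
  end.

Definition before bs v := foldl (fun u c => step c u) v bs.
Definition after bs w := foldr (fun c u => step (mirror c) u) w bs.

(** Weighted count of the staircases satisfying [q] in block [c]. Entering at 0 selects [v.1];
    leaving at 3 means entering the next block, whose base is 2 higher, at 1, and selects [w.1]. *)
Definition joint (q : rel nat) c v w : R :=
  \sum_(t <- stairs (block_walls c) 0)
     (q (nth 0 t 0) (nth 0 t 1))%:R *
     ((if nth 0 t 0 == 0%N then v.1 else v.2) *
      (if nth 0 t 1 == 3%N then w.1 else w.2)).

Lemma size_stairs_ladder bs :
  ((size (stairs (ladder_walls bs) 1))%:R, (size (stairs (ladder_walls bs) 0))%:R)
  = after bs (1, 1).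
Proof.
elim: bs => [|c bs IHbs] //=.
rewrite -IHbs.
have H p : size (stairs (ladder_walls (c :: bs)) p) =
    (\sum_(t1 <- stairs (block_walls c) p)
     size (stairs (ladder_walls bs) (last p t1 - 2)))%N.
  have := count_ladder_head (fun _ _ => true) c bs p.
  rewrite (eq_count (a2 := predT)) // count_predT => ->.
  by apply: eq_bigr => *; exact: mul1n.
rewrite !{}H.
by case: c; rewrite /= !big_cons !big_nil /= !natrD; congr pair; ring.
Qed.

(* The factor [v.2 - v.1] counts the staircases that can only be continued at
   relative height at least 1. *)
Lemma count_ladder_transfer q b1 bs v :
  let V bs' k p := (count (local_event q k) (stairs (ladder_walls bs') p))%:R : R in
  v.1 * V (b1 ++ bs) (size b1) 0%N + (v.2 - v.1) * V (b1 ++ bs) (size b1) 1%N =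
  (before b1 v).1 * V bs 0%N 0%N + ((before b1 v).2 - (before b1 v).1) * V bs 0%N 1%N.
Proof.
move=> V; elim: b1 v => [|c b1 IHb] v //=.
rewrite -IHb {1 2}/V !count_ladder_cons.
by case: c; rewrite /= !big_cons !big_nil /= !natrD -![(count _ _)%:R]/(V _ _ _); ring.
Qed.

Lemma count_ladder q b1 c b2 :
  (count (local_event q (size b1)) (stairs (ladder_walls (b1 ++ c :: b2)) 0))%:R =
  joint q c (before b1 (1, 1)) (after b2 (1, 1)).
Proof.
(* With the initial pair [(1, 1)] the term with factor [v.2 - v.1] vanishes, leaving the staircases
   that start at 0. *)
have := count_ladder_transfer q b1 (c :: b2) (1, 1).
rewrite /= subrr mul0r addr0 mul1r => ->.
rewrite -size_stairs_ladder !count_ladder_head /joint.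
move: (before b1 _) => [A B].
by case: c; rewrite /= !big_cons !big_nil /= !natrD !natrM; ring.
Qed.

End Weights.

(** * Balance of the ladder *)

Local Open Scope ring_scope.

Definition left_end := [:: NoLeft; NoLeft; Full; Full; NoLeft].
Definition right_end := [:: NoRight; Full; Full; NoRight; NoRight].
Definition rungs K := left_end ++ nseq K Full ++ right_end.

Lemma cat_eq_cat_cons T (s1 s2 b1 : seq T) c b2 : s1 ++ s2 = b1 ++ c :: b2 ->
  (exists2 b, s1 = b1 ++ c :: b & b2 = b ++ s2) \/
  (exists2 b, b1 = s1 ++ b & s2 = b ++ c :: b2).
Proof.
elim: s1 b1 => [|x s1 IHs] [|y b1] //=; first by right; exists [::].
- by right; exists (y :: b1).
- by case=> -> <-; left; exists s1.
case=> -> /IHs[[b -> ->]|[b -> ->]]; first by left; exists b.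
by right; exists b.
Qed.

Lemma nseq_eq_cat_cons T K (x : T) b1 c b2 : nseq K x = b1 ++ c :: b2 ->
  exists i j, [/\ b1 = nseq i x, c = x & b2 = nseq j x].
Proof.
elim: K b1 => [|K IHK] [|y b1] //=; first by case=> -> <-; exists 0%N, K.
by case=> <- /IHK[i [j [-> -> ->]]]; exists i.+1, j.
Qed.

Definition coord e s : rel nat := fun x y => ((if e == 0 then x else y) <= s)%N.
Definition coordC e s : rel nat := fun x y => ~~ coord e s x y.

Ltac expand_joint :=
  rewrite /joint /coordC /coord !unlock /= ?(mul1r, mul0r, add0r, addr0).

Section Balance.
Variable R : realFieldType.

Definition local_balance e s c v w : R :=
  Num.min (joint (coord e s) c v w) (joint (coordC e s) c v w) /
  joint (fun _ _ => true) c v w.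

Lemma cut_balance_local b1 c b2 e s : (e < 2)%N ->
  cut_balance (ladder (b1 ++ c :: b2)) R ((size b1).*2 + e) ((size b1).*2 + s) =
  local_balance e s c (before b1 (1, 1)) (after b2 (1, 1)).
Proof.
move=> e2; rewrite /cut_balance /local_balance -!count_ladder.
set k := size b1.
have nthE t : ((nth 0 t (k.*2 + e) <= k.*2 + s) = local_event (coord e s) k t)%N.
  by rewrite /local_event /coord; case: e e2 => [|[|]] //= _;
    rewrite ?addn0 ?addn1 leq_subLR.
congr (Num.min _%:R _%:R / _%:R).
- exact: eq_count.
- by apply: eq_count => t; rewrite ltnNge nthE.
Qed.

Lemma local_balance_le e s c v w r : 0 < joint (fun _ _ => true) c v w ->
  joint (coord e s) c v w <= r * joint (fun _ _ => true) c v w \/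
  joint (coordC e s) c v w <= r * joint (fun _ _ => true) c v w ->
  local_balance e s c v w <= r.
Proof.
move=> J0 le_r; rewrite /local_balance ler_pdivrMr // ge_min.
by apply/orP.
Qed.

Definition core K : R * R := iter K (step Full) (before left_end (1, 1)).

Definition slope_in a b (v : R * R) :=
  [/\ 0 < v.1, a * v.1 <= v.2 & v.2 <= b * v.1].

(** The initial slope is 35784/19212, and the slope map [r |-> (4 + 6 r) / (3 + 3 r)] of a full
    block sends [[7/4, 15/8]] into itself. *)
Lemma core_slope K : slope_in (7%:R / 4%:R) (15%:R / 8%:R) (core K).
Proof.
elim: K => [|K [h1 h2 h3]]; first by rewrite /core; split=> /=; lra.
by rewrite /core iterS -/(core K); split=> /=; lra.
Qed.

Lemma before_cat b1 b2 v : before (b1 ++ b2) v = before b2 (before b1 v) :> R * R.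
Proof. exact: foldl_cat. Qed.

Lemma after_cat b1 b2 v : after (b1 ++ b2) v = after b1 (after b2 v) :> R * R.
Proof. exact: foldr_cat. Qed.

Lemma before_core K : before (left_end ++ nseq K Full) (1, 1) = core K.
Proof.
rewrite /core /before foldl_cat; move: (foldl _ _ left_end).
by elim: K => //= K IHK v; rewrite IHK -iterSr.
Qed.

(** The right end is the left end turned upside down, so both produce the same pair. *)
Lemma after_core K : after (nseq K Full ++ right_end) (1, 1) = core K.
Proof. by rewrite /after foldr_cat; elim: K => //= K ->. Qed.

Lemma rungs_ind K (Pr : block -> R * R -> R * R -> Prop) :
  (forall b1 c b2, left_end = b1 ++ c :: b2 ->
     Pr c (before b1 (1, 1)) (after b2 (core K))) ->
  (forall i j, Pr Full (core i) (core j)) ->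
  (forall b1 c b2, right_end = b1 ++ c :: b2 ->
     Pr c (before b1 (core K)) (after b2 (1, 1))) ->
  forall b1 c b2, rungs K = b1 ++ c :: b2 ->
    Pr c (before b1 (1, 1)) (after b2 (1, 1)).
Proof.
move=> PrL PrM PrR b1 c b2 rE.
have [[b2' lE ->]|[b1' -> rE']] := @cat_eq_cat_cons _ left_end _ _ _ _ rE.
  by rewrite after_cat after_core; exact: PrL.
have [[b2'' fE ->]|[b1'' -> rE'']] := cat_eq_cat_cons rE'.
  have [i [j [-> -> ->]]] := nseq_eq_cat_cons fE.
  by rewrite before_core after_core; exact: PrM.
by rewrite catA before_cat before_core; exact: PrR.
Qed.

Definition end_balance K : R :=
  local_balance 0 0 NoLeft (1, 1) (after [:: NoLeft; Full; Full; NoLeft] (core K)).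

(** If the pair on the right of the first block has slope [r], the balance is
    [(1 + 2 r) / (4 + 5 r)], increasing in [r] and equal to 15/43 at [r = 17/11]. The latter is the
    image of 7/4 under [step NoRight], and the slope entering that last step stays above 7/4. *)
Lemma end_balance_ge K : 15%:R / 43%:R <= end_balance K.
Proof.
rewrite /end_balance /local_balance; have [] := core_slope K.
case: (core K) => A B /= h1 h2 h3.
rewrite ler_pdivlMr; last by expand_joint; lra.
by rewrite le_min; apply/andP; split; expand_joint; lra.
Qed.

Ltac bound_events :=
  apply: local_balance_le; expand_joint; first [lra | left; lra | right; lra].

(* The events are bilinear in [v] and [w]; together with these products, the
   bounds on them become linear in the four monomials. *)
Lemma slope_in_mul a b c d v w : slope_in a b v -> slope_in c d w ->
  [/\ 0 < v.1 * w.1, 0 <= (v.2 - a * v.1) * (w.2 - c * w.1),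
      0 <= (v.2 - a * v.1) * (d * w.1 - w.2),
      0 <= (b * v.1 - v.2) * (w.2 - c * w.1)
    & 0 <= (b * v.1 - v.2) * (d * w.1 - w.2)].
Proof.
by move=> [v0 av vb] [w0 cw wd]; split; rewrite (mulr_gt0, mulr_ge0) ?subr_ge0.
Qed.

(** The lower bound 3/2 for [w] also covers a broken block on the right, after which the slope drops
    to between 17/11 and 107/69. *)
Lemma full_balance_le v w e s : (e < 2)%N -> (s < 3)%N ->
  slope_in (7%:R / 4%:R) (15%:R / 8%:R) v ->
  slope_in (3%:R / 2%:R) (15%:R / 8%:R) w ->
  local_balance e s Full v w <= 15%:R / 43%:R.
Proof.
move=> e2 s3 vP wP; have := slope_in_mul vP wP => {vP wP}.
case: v w => [A B] [Y X] [/= m0 m1 m2 m3 m4].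
by case: e e2 => [|[|]] // _; case: s s3 => [|[|[|]]] // _; bound_events.
Qed.

(** Covers the second and fifth blocks of the left end, where [v] has slopes 9/5 and 4644/2640. *)
Lemma noleft_balance_le v w e s : (e < 2)%N -> (s < 3)%N ->
  slope_in (7%:R / 4%:R) (9%:R / 5%:R) v ->
  slope_in (7%:R / 4%:R) (15%:R / 8%:R) w ->
  local_balance e s NoLeft v w <= 15%:R / 43%:R.
Proof.
move=> e2 s3 vP wP; have := slope_in_mul vP wP => {vP wP}.
case: v w => [A B] [Y X] [/= m0 m1 m2 m3 m4].
by case: e e2 => [|[|]] // _; case: s s3 => [|[|[|]]] // _; bound_events.
Qed.

Lemma first_balance_le w e s : (e < 2)%N -> (s < 3)%N -> (e, s) != (0, 0)%N ->
  slope_in (3%:R / 2%:R) (11%:R / 7%:R) w ->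
  local_balance e s NoLeft (1, 1) w <= 15%:R / 43%:R.
Proof.
case: w => [Y X] e2 s3 es [/= q0 q1 q2].
by case: e e2 es => [|[|]] // _; case: s s3 => [|[|[|]]] // _ _;
  bound_events.
Qed.

Lemma left_end_split b1 c b2 : left_end = b1 ++ c :: b2 ->
  [\/ [/\ b1 = [::], c = NoLeft & b2 = [:: NoLeft; Full; Full; NoLeft]],
      [/\ b1 = [:: NoLeft], c = NoLeft & b2 = [:: Full; Full; NoLeft]],
      [/\ b1 = [:: NoLeft; NoLeft], c = Full & b2 = [:: Full; NoLeft]] |
      [/\ b1 = [:: NoLeft; NoLeft; Full], c = Full & b2 = [:: NoLeft]] \/
      [/\ b1 = [:: NoLeft; NoLeft; Full; Full], c = NoLeft & b2 = [::]]].
Proof.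
case: b1 => [|x1 b1] /=; first by case=> <- <-; constructor 1.
case: b1 => [|x2 b1] /=; first by case=> <- <- <-; constructor 2.
case: b1 => [|x3 b1] /=; first by case=> <- <- <- <-; constructor 3.
case: b1 => [|x4 b1] /=; first by case=> <- <- <- <- <-; constructor 4; left.
case: b1 => [|x5 b1] /=; first by case=> <- <- <- <- <- <-; constructor 4; right.
by case: b1.
Qed.

Lemma left_balance_le K b1 c b2 e s : left_end = b1 ++ c :: b2 ->
  (e < 2)%N -> (s < 3)%N ->
  local_balance e s c (before b1 (1, 1)) (after b2 (core K)) <= end_balance K.
Proof.
move=> /left_end_split lE e2 s3.
have le_end c' v w : local_balance e s c' v w <= 15%:R / 43%:R ->
    local_balance e s c' v w <= end_balance K.
  by move=> H; apply: le_trans H (end_balance_ge K).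
have cK := core_slope K; have [h1 h2 h3] := cK.
case: lE => [||| []] [-> -> ->].
- have [[-> ->]|es] := eqVneq (e, s) (0, 0)%N; first exact: lexx.
  by apply/le_end/first_balance_le => //; split=> /=; lra.
- by apply/le_end/noleft_balance_le => //; split=> /=; lra.
- by apply/le_end/full_balance_le => //; split=> /=; lra.
- by apply/le_end/full_balance_le => //; split=> /=; lra.
- by apply/le_end/noleft_balance_le => //; split=> /=; lra.
Qed.

(** * Half-turn symmetry and the right end *)

Lemma joint_mirror q c v w :
  joint q c v w = joint (fun x y => q (3 - y)%N (3 - x)%N) (mirror c) w v :> R.
Proof. by case: c; expand_joint; ring. Qed.

Lemma eq_joint q q' c v w :
  (forall x y, (x <= 3)%N -> (y <= 3)%N -> q x y = q' x y) ->
  joint q c v w = joint q' c v w :> R.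
Proof. by move=> qq'; case: c; expand_joint; rewrite !qq'. Qed.

(** The half-turn swaps the columns, and [3 - h <= s] is the negation of [h <= 2 - s]: the event and
    its complement are exchanged, which the minimum does not see. *)
Lemma local_balance_mirror e s c v w : (e < 2)%N -> (s < 3)%N ->
  local_balance e s c v w =
  local_balance (1 - e)%N (2 - s)%N (mirror c) w v.
Proof.
move=> e2 s3; rewrite /local_balance minC ![joint _ c v w]joint_mirror.
congr (Num.min _ _ / _); apply: eq_joint => x y x3 y3; rewrite /coordC /coord;
  case: e e2 => [|[|]] //= _; lia.
Qed.

Definition reflect_blocks bs := rev (map mirror bs).

Lemma mirrorK : involutive mirror.
Proof. by case. Qed.

Lemma before_reflect bs v : before (reflect_blocks bs) v = after bs v :> R * R.
Proof. by rewrite /before /reflect_blocks foldl_rev /after foldr_map. Qed.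

Lemma after_reflect bs v : after (reflect_blocks bs) v = before bs v :> R * R.
Proof.
rewrite -before_reflect /reflect_blocks map_rev revK -map_comp.
by rewrite (eq_map mirrorK) map_id.
Qed.

Lemma right_balance_le K b1 c b2 e s : right_end = b1 ++ c :: b2 ->
  (e < 2)%N -> (s < 3)%N ->
  local_balance e s c (before b1 (core K)) (after b2 (1, 1)) <= end_balance K.
Proof.
move=> rE e2 s3; rewrite local_balance_mirror // -after_reflect -before_reflect.
apply: left_balance_le; try lia.
rewrite -[left_end]/(reflect_blocks right_end) rE /reflect_blocks.
by rewrite map_cat rev_cat /= rev_cons cat_rcons.
Qed.

Lemma middle_balance_le K i j e s : (e < 2)%N -> (s < 3)%N ->
  local_balance e s Full (core i) (core j) <= end_balance K.
Proof.
move=> e2 s3; apply: le_trans (end_balance_ge K).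
apply: full_balance_le => //; first exact: core_slope.
by have [? ? ?] := core_slope j; split=> //; lra.
Qed.

Lemma rungs_balance_le K b1 c b2 e s : rungs K = b1 ++ c :: b2 ->
  (e < 2)%N -> (s < 3)%N ->
  local_balance e s c (before b1 (1, 1)) (after b2 (1, 1)) <= end_balance K.
Proof.
move=> rE e2 s3; pose Pr c v w := local_balance e s c v w <= end_balance K.
apply: (@rungs_ind K Pr) rE => [a1 d a2 lE|i j|a1 d a2 rE]; rewrite /Pr.
- exact: left_balance_le.
- exact: middle_balance_le.
- exact: right_balance_le.
Qed.

End Balance.

Lemma balance_rungs (R : realFieldType) K :
  balance_constant (strip_carrier (ladder (rungs K))) R = end_balance R K.
Proof.
have cut0 : cut_balance (ladder (rungs K)) R 0 0 = end_balance R K.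
  have := cut_balance_local R [::] NoLeft (behead (rungs K)) (e := 0) 0 isT.
  rewrite /end_balance -after_core -after_cat; exact.
rewrite -cut0; apply: balance_constant_eq => //.
move=> i j; rewrite /lo /hi -[walls _]/(ladder_walls (rungs K)) size_ladder_walls.
rewrite -(odd_double_half i) addnC; set k := (i./2); set e := nat_of_bool _ => im.
have e2 : (e < 2)%N by rewrite /e; case: odd.
have kK : (k < size (rungs K))%N by lia.
rewrite nth_ladder_walls //= => /andP[lj jh].
set c := nth Full (rungs K) k in lj jh.
have [s s3 ->] : exists2 s, (s < 3)%N & j = (k.*2 + s)%N.
  exists (j - k.*2)%N; last by lia.
  suff : ((nth (0, 0) (block_walls c) e).2 <= 3)%N by lia.
  by clear; case: c; case: e => [|[|[|]]].
have rE : rungs K = take k (rungs K) ++ c :: drop k.+1 (rungs K).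
  by rewrite -drop_nth // cat_take_drop.
have kE : k = size (take k (rungs K)) by rewrite size_takel // ltnW.
by rewrite cut0; have := rungs_balance_le R rE e2 s3; rewrite -cut_balance_local // -kE -rE.
Qed.

Local Open Scope classical_set_scope.

(** * Convergence of the slope and of the balance *)

Section Limit.
Variable R : realType.

Definition slope K : R := (core R K).2 / (core R K).1.

Definition rho : R := (3%:R + Num.sqrt 57%:R) / 6%:R.

(** This is the fixed-point equation [r (3 + 3 r) = 4 + 6 r] of the slope map of a full block. *)
Lemma rho_eq : 3%:R * rho * rho = 3%:R * rho + 4%:R.
Proof.
have : Num.sqrt (57%:R : R) * Num.sqrt 57%:R = 57%:R by rewrite -expr2 sqr_sqrtr.
by rewrite /rho; move: (Num.sqrt _) => s ss; lra.
Qed.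

Lemma rho_gt : 7%:R / 4%:R < rho.
Proof.
have : 0 <= Num.sqrt (57%:R : R) by exact: sqrtr_ge0.
have : Num.sqrt (57%:R : R) * Num.sqrt 57%:R = 57%:R by rewrite -expr2 sqr_sqrtr.
by rewrite /rho; move: (Num.sqrt _) => s ss s0; nra.
Qed.

Lemma slope_ge K : 7%:R / 4%:R <= slope K.
Proof. by have [h1 h2 _] := core_slope R K; rewrite ler_pdivlMr. Qed.

Lemma slopeS K : slope K.+1 =
  (4%:R + 6%:R * slope K) / (3%:R + 3%:R * slope K).
Proof.
have [h1 h2 _] := core_slope R K; rewrite /slope /core iterS -/(core R K) /=.
case: (core R K) h1 h2 => A B /= h1 h2.
by field; apply/andP; split; apply: lt0r_neq0; lra.
Qed.

Lemma slope_contract K : `|slope K.+1 - rho| <= 2%:R^-1 * `|slope K - rho|.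
Proof.
rewrite slopeS; have := slope_ge K; move: (slope K) => r r_ge.
have rho_gt := rho_gt; have rho_eq := rho_eq; have rho_le : rho <= 2%:R by nra.
(* By the fixed-point equation [4 - 3 rho = - (6 - 3 rho) rho], so [r - rho] factors out; both [r]
   and [rho] being at least 7/4, its coefficient is below 1/2. *)
have -> : (4%:R + 6%:R * r) / (3%:R + 3%:R * r) - rho =
    (6%:R - 3%:R * rho) / (3%:R + 3%:R * r) * (r - rho).
  have d0 : 3%:R + 3%:R * r != 0 by apply: lt0r_neq0; lra.
  apply: (mulIf d0); rewrite mulrBl divfK // [RHS]mulrAC divfK //; lra.
rewrite normrM ler_wpM2r // ger0_norm.
  by rewrite ler_pdivrMr; lra.
by rewrite divr_ge0; lra.
Qed.

Lemma cvg_slope : slope K @[K --> \oo] --> rho.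
Proof.
apply/subr_cvg0; apply: norm_cvg0.
have bnd K : `|slope K - rho| <= `|slope 0 - rho| * 2%:R^-1 ^+ K.
  elim: K => [|K IHK]; first by rewrite expr0 mulr1.
  apply: le_trans (slope_contract K) _.
  by rewrite exprS mulrCA ler_wpM2l // invr_ge0.
have bnd_cvg0 : `|slope 0 - rho| * 2%:R^-1 ^+ K @[K --> \oo] --> (0 : R).
  rewrite -[X in _ --> X](mulr0 `|slope 0 - rho|).
  apply: cvgMl_tmp; apply: cvg_expr.
  by rewrite ger0_norm ?invr_ge0 // invf_lt1 // ltr1n.
apply: (@squeeze_cvgr nat \oo _ R (fun=> 0) _ _ _ 0 (cvg_cst _) bnd_cvg0).
by near=> K; rewrite normr_ge0 bnd.
Unshelve. all: by end_near.
Qed.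

(** Carrying [(1, r)] through the four blocks gives [Y = 1413 + 1638 r] and [X = 2184 + 2532 r]; the
    balance is [(Y + 2 X) / (4 Y + 5 X)], here simplified by 3. *)
Lemma end_balance_slope K : end_balance R K =
  (1927%:R + 2234%:R * slope K) / (4%:R * (1381%:R + 1601%:R * slope K)).
Proof.
have [h1 h2 h3] := core_slope R K; rewrite /slope /end_balance /local_balance.
case: (core R K) h1 h2 h3 => A B /= h1 h2 h3.
rewrite min_l; last by expand_joint; lra.
expand_joint.
by field; apply/and3P; split; apply: lt0r_neq0; lra.
Qed.

Lemma cvg_end_balance : end_balance R K @[K --> \oo] -->
  ((5864893%:R + 27%:R * Num.sqrt 57%:R) / 16812976%:R : R).
Proof.
have -> : (5864893%:R + 27%:R * Num.sqrt 57%:R) / 16812976%:R =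
    (1927%:R + 2234%:R * rho) / (4%:R * (1381%:R + 1601%:R * rho)).
  have := rho_gt.
  have : Num.sqrt (57%:R : R) * Num.sqrt 57%:R = 57%:R by rewrite -expr2 sqr_sqrtr.
  rewrite /rho; move: (Num.sqrt _) => s ss r7.
  by apply/eqP; rewrite eqr_div; first (apply/eqP; lra); apply: lt0r_neq0; lra.
under eq_fun do rewrite end_balance_slope.
have lin a b : a + b * slope K @[K --> \oo] --> a + b * rho.
  by apply: cvgD; [exact: cvg_cst | apply: cvgMl_tmp; exact: cvg_slope].
apply: cvgM; first exact: lin.
apply: cvgV; last by apply: cvgMl_tmp; exact: lin.
by have := rho_gt => ?; apply: lt0r_neq0; lra.
Qed.

End Limit.

Theorem theorem1p5 (R : realType) :
  exists (d : Order.disp_t) (T : nat -> finPOrderType d),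
    (forall n : nat, (1 <= n)%N -> width (T n) = 2%N) /\
    (balance_constant (T n) R @[n --> \oo] -->
      ((5864893%:R + 27%:R * Num.sqrt 57%:R) / 16812976%:R : R)).
Proof.
exists (Order.Disp tt tt), (fun K => strip_carrier (ladder (rungs K))).
split=> [K _|]; last first.
  by under eq_fun do rewrite balance_rungs; exact: cvg_end_balance.
(* The wall of [a_0] is [(0, 3)], so [a_0] and [b_0] are incomparable. *)
pose i := @Ordinal (size (walls (ladder (rungs K)))) 0 isT.
pose j := @Ordinal (height (ladder (rungs K))) 0 isT.
exact: (@width_strip (ladder (rungs K)) i j).
Qed.
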